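(* Let $L\in\mathbb{R}^{\ell\times\ell}\langle x,x^*\rangle$ be a monic linear pencil and let $I_L=\mathbb{R}^{1\times\ell}\langle x,x^*\rangle L$. Then $I_L=\sqrt[\mathrm{re}]{I_L}=\sqrt{I_L}$.
   Context: Let $x=(x_1,\dots,x_g)$, let $\langle x,x^*\rangle$ be the free monoid on the $2g$ letters $x_1,\dots,x_g,x_1^*,\dots,x_g^*$ (the empty word is $1$), and let $\mathbb{R}\langle x,x^*\rangle$ be the free real algebra on it, with the linear involution $*$ exchanging $x_i$ and $x_i^*$ and satisfying $(pq)^*=q^*p^*$. Elements of $\mathbb{R}^{\nu\times\ell}\langle x,x^*\rangle$ (matrices over $\mathbb{R}\langle x,x^*\rangle$) are written $p=\sum_w A_w\otimes w$; $p^*=\sum_w A_w^*\otimes w^*$, where $A^*$ is the transpose. For a tuple $X=(X_1,\dots,X_g)$ of real $n\times n$ matrices, $p(X)=\sum_w A_w\otimes w(X)$ (Kronecker product), with $x_i\mapsto X_i$, $x_i^*\mapsto X_i^*$ (transpose), empty word $\mapsto\mathrm{Id}_n$. A linear pencil is a symmetric ($L=L^*$) square matrix polynomial of degree at most $1$; it is monic if $L(0)$ is the identity. A left module is a left $\mathbb{R}\langle x,x^*\rangle$-submodule $I$ of $\mathbb{R}^{1\times\ell}\langle x,x^*\rangle$ (entrywise left multiplication); $I_L$ is the left module generated by the rows of $L$. $\mathbb{R}^{\ell\times1}I$ denotes the $\ell\times\ell$ matrices all of whose rows lie in $I$, and $I^*\mathbb{R}^{1\times\ell}=(\mathbb{R}^{\ell\times1}I)^*$.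 $I$ is real if whenever $\sum_i^{\rm finite}p_i^*p_i\in\mathbb{R}^{\ell\times1}I+I^*\mathbb{R}^{1\times\ell}$ with $p_i\in\mathbb{R}^{1\times\ell}\langle x,x^*\rangle$, each $p_i\in I$. $\sqrt[\mathrm{re}]{I}$ is the smallest real left module containing $I$. $V(I)$ is the set of all $(X,v)\in(\mathbb{R}^{n\times n})^g\times\mathbb{R}^{\ell n}$, $n\in\mathbb{N}$ arbitrary, with $\iota(X)v=0$ for all $\iota\in I$, and $\sqrt I=\{p\in\mathbb{R}^{1\times\ell}\langle x,x^*\rangle: p(X)v=0\text{ for all }(X,v)\in V(I)\}$. *)

(* Defs.v *)
From mathcomp Require Import all_boot all_algebra finmap.
From mathcomp Require Import boolp classical_sets reals.
From mathcomp Require Import mxtens.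
From mathcomp Require Import monalg.

Set Implicit Arguments.
Unset Strict Implicit.
Unset Printing Implicit Defensive.

Import GRing.Theory.
Local Open Scope classical_set_scope.
Local Open Scope ring_scope.

(* The letter [inl i] is x_i and the letter [inr i] is x_i^*. *)
Definition letter (g : nat) : choiceType := ('I_g + 'I_g)%type.

Definition word (g : nat) : monomType := {fmonom (letter g)}.

Definition ncpoly (R : realType) (g : nat) : lalgType R := {malg R[word g]}.

Section NCPoly.
Variables (R : realType) (g : nat).
Local Notation A := (ncpoly R g).

Definition letter_star (a : letter g) : letter g :=
  match a with inl i => inr i | inr i => inl i end.

Definition word_star (w : word g) : word g :=
  FMonom (rev (map letter_star w)).

Definition star (p : A) : A := \sum_(w <- msupp p) << p@_w *g word_star w >>.

Definition mxstar m n (p : 'M[A]_(m, n)) : 'M[A]_(n, m) := map_mx star p^T.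

(* The coefficient A_w of p = \sum_w A_w (x) w. *)
Definition mxcoef m n (w : word g) (p : 'M[A]_(m, n)) : 'M[R]_(m, n) :=
  map_mx (mcoeff w) p.

Definition mxsupp m n (p : 'M[A]_(m, n)) : {fset (word g)} :=
  \big[fsetU/fset0]_(ij : 'I_m * 'I_n) msupp (p ij.1 ij.2).

Definition letter_eval n (X : 'I_g -> 'M[R]_n) (a : letter g) : 'M[R]_n :=
  match a with inl i => X i | inr i => (X i)^T end.

Definition word_eval n (X : 'I_g -> 'M[R]_n) (w : word g) : 'M[R]_n :=
  \big[mulmx/1%:M]_(a <- (w : seq (letter g))) letter_eval X a.

Definition mxeval m l n (X : 'I_g -> 'M[R]_n) (p : 'M[A]_(m, l)) :
    'M[R]_(m * n, l * n) :=
  \sum_(w <- mxsupp p) mxcoef w p *t word_eval X w.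

(* [mmeasure] is the degree plus one, and 0 on the zero polynomial. *)
Definition linear_pencil l (L : 'M[A]_l) : Prop :=
  mxstar L = L /\ forall i j, (mmeasure (@fdeg (letter g)) (L i j) <= 2)%N.

(* L(0) is the value of L at the zero tuple of 1 x 1 matrices. *)
Definition monic_mx l (L : 'M[A]_l) : Prop :=
  mxeval (fun=> 0 : 'M[R]_1) L = 1%:M.

Section LeftModules.
Variable l : nat.
Implicit Types I : set 'rV[A]_l.

Definition left_module I : Prop := GRing.submod_closed [in I].

Definition row_module (L : 'M[A]_l) : set 'rV[A]_l :=
  [set q *m L | q in [set: 'rV[A]_l]].

(* R^{l x 1} I, and then R^{l x 1} I + I^* R^{1 x l}. *)
Definition col_module I : set 'M[A]_l := [set M | forall i, I (row i M)].

Definition sym_module I : set 'M[A]_l :=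
  [set M + mxstar N | M in col_module I & N in col_module I].

Definition real_module I : Prop :=
  forall (k : nat) (p : 'I_k -> 'rV[A]_l),
    sym_module I (\sum_(i < k) mxstar (p i) *m p i) -> forall i, I (p i).

Definition real_radical I : set 'rV[A]_l :=
  smallest [set J | left_module J /\ real_module J] I.

(* The points of V(I) whose matrices have size n. *)
Definition zeros I n : set (('I_g -> 'M[R]_n) * 'cV[R]_(l * n)) :=
  [set Xv | forall p, I p -> mxeval Xv.1 p *m Xv.2 = 0].

Definition zero_radical I : set 'rV[A]_l :=
  [set p | forall n Xv, zeros I Xv -> mxeval (n := n) Xv.1 p *m Xv.2 = 0].

End LeftModules.
End NCPoly.

(* Main.v *)
From HB Require Import structures.
Require Import Defs.
From mathcomp Require Import all_boot all_algebra finmap.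
From mathcomp Require Import boolp classical_sets reals.
From mathcomp Require Import mxtens.
From mathcomp Require Import monalg.

(** Write L = 1 + sum_a A_a a, where a runs over the 2g letters; L = L^* says
    that A_(a^* ) = A_a^T.  The zero radical sqrt(I) of any I is a real left
    module, because v^T (sum_i p_i^* p_i)(X) v is the sum of the squared norms
    of the p_i(X) v, and it contains I.  So both equalities follow from
    the inclusion of sqrt(I_L) in I_L ([zero_radical_sub_row_module]): if p is
    not in I_L, there is a zero (X, v) of L with p(X) v <> 0.

    The zeros are finite truncations of a Fock space.  At its ground level
    (lemma [ground_level]) put the vectors v_i = (A_a^T e_i)_a, the rows of a
    matrix V with Gram matrix S = V V^T = sum_a A_a A_a^T.  There is D with
    S D = V, and the operators T_a = - D^T A_a D satisfy T_(a^* ) = T_a^T.  As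
    V D^T A_a = A_a, sum_a A_a V T_a^T = - S D = - V, which says that (T, v) is a
    zero of L.  A row of scalars c vanishes at it only when c A_a = 0 for all a,
    and then c = c L lies in I_L.

    For a row p of degree k + 1, fix a word s of length k and let c_a be the
    coefficient of s a in p.  Modulo the rows c with c A_b = 0 for all b,
    either c_a = u A_a for a single row u, or, by the Fredholm
    alternative, there are y_a such that sum_a A_a V y_a = 0 and
    sum_a c_a V y_a <> 0.  In the second case add to the ground level a chain
    of k + 1 basis vectors: the letter a sends a ground vector z to
    <y_a, z> times the first basis vector, and the letters
    of s, read from right to left, lead from each basis vector to the next;
    the transposes of these maps are added so that a and a^* act by transposed
    matrices.  The equation on y keeps (X, v) a zero of L.  Since every
    letter climbs at most one step, a word of length at most k + 1 reaches the
    end of the chain only if it is some s a, and the last coordinate of p(X) v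
    is sum_a c_a V y_a <> 0 ([top_coefs_mod_pencil]).

    So if p is in sqrt(I_L) the first case holds for every s.  Subtracting
    from p the element sum_s u_s s L of I_L, and then the part of degree k + 1 of
    the difference, whose coefficients c satisfy c A_b = 0 and which
    therefore lies in I_L, lowers the degree of p; induct on it. *)

Set Implicit Arguments.
Unset Strict Implicit.
Unset Printing Implicit Defensive.

Import GRing.Theory Num.Theory.
Local Open Scope ring_scope.

(** * Families of matrices indexed by a finite type *)

Section IndexedRows.
Variables (R : realFieldType) (E : finType).

Lemma gram_eq0 r m (M : 'M[R]_(r, m)) : M *m M^T = 0 -> M = 0.
Proof.
move=> MM; apply/matrixP => i j; rewrite mxE; apply/eqP; rewrite -sqrf_eq0.
move/matrixP/(_ i i)/eqP: MM; rewrite !mxE.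
under eq_bigr do rewrite mxE -expr2.
rewrite psumr_eq0 => [/allP|k _]; last exact: sqr_ge0.
by apply; exact: mem_index_enum.
Qed.

Definition hcat r m (F : E -> 'M[R]_(r, m)) := \mxrow_(i < #|E|) F (enum_val i).

Lemma mul_hcat k r m (c : 'M[R]_(k, r)) (F : E -> 'M[R]_(r, m)) :
  c *m hcat F = hcat (fun a => c *m F a).
Proof. exact: mul_mxrow. Qed.

Lemma hcat_mulT r r' m (F : E -> 'M[R]_(r, m)) (G : E -> 'M[R]_(r', m)) :
  hcat F *m (hcat G)^T = \sum_a F a *m (G a)^T.
Proof.
by rewrite tr_mxrow mul_mxrow_mxcol -(big_enum_val (fun a => F a *m (G a)^T)).
Qed.

Lemma hcat_inj r m (F G : E -> 'M[R]_(r, m)) : hcat F = hcat G -> F =1 G.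
Proof.
move=> FG a; have := congr1 (fun M => submxrow M (enum_rank a)) FG.
by rewrite /hcat !mxrowK enum_rankK.
Qed.

Lemma hcat_splitT m (y : 'cV[R]_(\sum_(i < #|E|) m)) :
  exists z : E -> 'cV[R]_m, y = (hcat (fun a => (z a)^T))^T.
Proof.
exists (fun a => submxcol y (enum_rank a)).
rewrite tr_mxrow -{1}[y]submxcolK; apply: eq_mxcol => i.
by rewrite trmxK enum_valK.
Qed.

(** A vector outside a row space is detected by a linear form that vanishes on
    that space; the cokernel matrix lists such forms.  The family form lets one
    u serve all indices at once. *)
Lemma fredholm_alternative l m (b : E -> 'rV[R]_m) (B : E -> 'M[R]_(l, m)) :
  (exists u, forall a, b a = u *m B a) \/
  exists2 y : E -> 'cV[R]_m, \sum_a B a *m y a = 0 & \sum_a b a *m y a != 0.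
Proof.
case: (boolP (hcat b <= hcat B)%MS) => [/submxP [u]|].
  by rewrite mul_hcat => /hcat_inj bu; left; exists u.
rewrite submxE => /matrix0Pn [i [j nz]]; right.
have [z zE] := hcat_splitT (col j (cokermx (hcat B))).
have zP r (F : E -> 'M[R]_(r, m)) :
    \sum_a F a *m z a = col j (hcat F *m cokermx (hcat B)).
  rewrite colE -mulmxA -colE zE hcat_mulT.
  by apply: eq_bigr => a _; rewrite trmxK.
exists z; first by rewrite zP mulmx_coker; apply/matrixP => s t; rewrite !mxE.
by apply/matrix0Pn; exists i, 0; rewrite zP mxE.
Qed.

(** Over an ordered field V and its Gram matrix have the same column space, so V
    can be divided by the Gram matrix even when the latter is singular. *)
Lemma sub_mul_gram l m (V : 'M[R]_(l, m)) :
  exists D : 'M[R]_(l, m), V *m V^T *m D = V.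
Proof.
have : (V^T <= V *m V^T)%MS.
  rewrite submxE; set C := cokermx _; apply/eqP/trmx_inj; rewrite trmx0.
  apply: gram_eq0.
  by rewrite trmxK trmx_mul trmxK -mulmxA (mulmxA V) mulmx_coker mulmx0.
case/submxP => D VD; exists D^T.
by apply: trmx_inj; rewrite !trmx_mul !trmxK -VD.
Qed.

(** The ground level of the zeros of the pencil 1 + sum_a A_a a.  The rows of V
    are its vectors, and the last equation says that T annihilates the pencil on
    them; the second clause, that c V = 0 happens only for the rows c with c L = c.
    Any D with V V^T D = V gives the operators T_a = - D^T A_a D, where V = (A_a)_a
    is chosen so that V V^T = sum_a A_a A_a^T. *)
Lemma ground_level l (s : E -> E) (A : E -> 'M[R]_l) :
  (forall a, A (s a) = (A a)^T) ->
  exists m, exists V : 'M[R]_(l, m), exists T : E -> 'M[R]_m,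
  [/\ forall a, T (s a) = (T a)^T,
      forall k (c : 'M[R]_(k, l)), c *m V = 0 -> forall a, c *m A a = 0
    & V + \sum_a A a *m V *m (T a)^T = 0].
Proof.
move=> As; exists (\sum_(i < #|E|) l)%N, (hcat A).
have [D SD] := sub_mul_gram (hcat A).
have kerV k (c : 'M[R]_(k, l)) : c *m hcat A = 0 -> forall a, c *m A a = 0.
  rewrite mul_hcat => c0; apply/hcat_inj; rewrite c0.
  by apply/esym/matrixP => i j; rewrite !mxE.
(* V D^T projects onto the common column space of the A_a: the rows of
   V D^T - 1 kill the Gram matrix, hence V, hence every A_a. *)
have VD a : hcat A *m D^T *m A a = A a.
  apply/eqP; rewrite -subr_eq0 -{2}[A a]mul1mx -mulmxBl; apply/eqP; move: a.
  apply: kerV; apply: gram_eq0.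
  rewrite trmx_mul mulmxA -(mulmxA _ (hcat A)) mulmxBl mul1mx -mulmxA.
  have -> : D^T *m (hcat A *m (hcat A)^T) = (hcat A)^T.
    by rewrite -[in RHS]SD !trmx_mul trmxK.
  by rewrite subrr mul0mx.
exists (fun a => - (D^T *m A a *m D)); split => // [a|].
  by rewrite As linearN /= !trmx_mul trmxK mulmxA.
have -> : \sum_a A a *m hcat A *m (- (D^T *m A a *m D))^T =
          - (\sum_a A a *m (A a)^T *m D).
  rewrite -sumrN; apply: eq_bigr => a _.
  by rewrite linearN /= !trmx_mul trmxK -As mulmxN -{2}(VD (s a)) -!mulmxA.
by rewrite -mulmx_suml -hcat_mulT SD subrr.
Qed.
End IndexedRows.

(** * Evaluation of noncommutative polynomials *)

Section LinearExtension.
Variables (R : realType) (g : nat) (V : lmodType R).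
Implicit Types (h : word g -> V) (p q : ncpoly R g).

(** Evaluation of words, as well as each matrix coefficient of it, extends
    linearly to polynomials in this way; the target is any module, since
    the matrices of size 0 do not form a nontrivial ring. *)
Definition linext h p : V := \sum_(w <- msupp p) p@_w *: h w.

Lemma linextEw (d : {fset word g}) h p :
  (msupp p `<=` d)%fset -> linext h p = \sum_(w <- d) p@_w *: h w.
Proof.
move=> le; rewrite /linext (big_fset_incl _ le) //= => w _ /mcoeff_outdom ->.
by rewrite scale0r.
Qed.

Lemma linext_is_zmod_morphism h : zmod_morphism (linext h).
Proof.
move=> p q /=; have le := fsubsetUl (msupp p) (msupp q).
have le' := fsubsetUr (msupp p) (msupp q).
rewrite (linextEw _ (msuppB_le p q)) (linextEw _ le) (linextEw _ le') -sumrB.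
by apply: eq_bigr => w _; rewrite mcoeffB scalerBl.
Qed.

HB.instance Definition _ h := GRing.isZmodMorphism.Build
  (ncpoly R g) V (linext h) (linext_is_zmod_morphism h).

Lemma linextU h c w : linext h << c *g w >> = c *: h w.
Proof. by rewrite (linextEw _ msuppU_le) big_seq_fset1 mcoeffUU. Qed.

Lemma linext_delta p w0 (x : V) :
  linext (fun w => (w == w0)%:R *: x) p = p@_w0 *: x.
Proof.
rewrite {2}[p]monalgE raddf_sum /= scaler_suml; apply: eq_bigr => w _.
by rewrite mcoeffU scalerA mulr_natr.
Qed.
End LinearExtension.

HB.instance Definition _ (R : realType) n := Monoid.isLaw.Build 'M[R]_n 1%:M
  (@mulmx R n n n) (@mulmxA R n n n n) (@mul1mx R n n) (@mulmx1 R n n).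

Lemma sum_mxtens (V : nmodType) l n (F : 'I_(l * n) -> V) :
  \sum_s F s = \sum_j \sum_k F (mxtens_index (j, k)).
Proof.
rewrite (reindex (@mxtens_index l n)) /=; last first.
  exists (@mxtens_unindex l n) => ? _; first by rewrite mxtens_indexK.
  by rewrite mxtens_unindexK.
by rewrite pair_bigA; apply: eq_bigr => -[].
Qed.

Section Evaluation.
Variables (R : realType) (g n : nat) (X : 'I_g -> 'M[R]_n).
Local Notation A := (ncpoly R g).
Implicit Types (p q : A) (u w : word g).

Lemma word_evalM u w :
  word_eval X (mmul u w) = word_eval X u *m word_eval X w.
Proof. by rewrite /word_eval fmM big_cat. Qed.

Lemma word_eval1 : word_eval X mone = 1%:M.
Proof. by rewrite /word_eval fm1 big_nil. Qed.

Lemma letter_eval_star a : letter_eval X (letter_star a) = (letter_eval X a)^T.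
Proof. by case: a => i //=; rewrite trmxK. Qed.

Lemma word_eval_star w : word_eval X (word_star w) = (word_eval X w)^T.
Proof.
case: w => s; rewrite /word_eval /word_star /=.
elim: s => [|a s IH]; first by rewrite !big_nil trmx1.
rewrite /= rev_cons -cats1 big_cat /= big_seq1 IH big_cons trmx_mul.
by rewrite letter_eval_star.
Qed.

Definition poly_eval p : 'M[R]_n := linext (word_eval X) p.

Lemma poly_evalM p q : poly_eval (p * q) = poly_eval p *m poly_eval q.
Proof.
rewrite malgME /poly_eval raddf_sum /= {2}/linext mulmx_suml.
apply: eq_bigr => u _; rewrite raddf_sum /= {2}/linext mulmx_sumr.
apply: eq_bigr => w _.
by rewrite linextU word_evalM -scalemxAl -scalemxAr scalerA.
Qed.

Lemma poly_eval_star p : poly_eval (star p) = (poly_eval p)^T.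
Proof.
rewrite /star /poly_eval raddf_sum /= {2}/linext raddf_sum /=.
by apply: eq_bigr => w _; rewrite linextU word_eval_star linearZ.
Qed.

Lemma mxevalE m l (p : 'M[A]_(m, l)) i k j k' :
  mxeval X p (mxtens_index (i, k)) (mxtens_index (j, k')) =
  poly_eval (p i j) k k'.
Proof.
have le : (msupp (p i j) `<=` mxsupp p)%fset.
  apply: (@bigfcup_sup _ _ _ (i, j) xpredT
    (fun ij => msupp (p ij.1 ij.2))) => //.
  by rewrite mem_index_enum.
rewrite /mxeval summxE /poly_eval (linextEw _ le) summxE.
by apply: eq_bigr => w _; rewrite tensmxE !mxE.
Qed.

Lemma mxeval_eqP m l (M : 'M[R]_(m * n, l * n)) (p : 'M[A]_(m, l)) :
  (forall i k j k', M (mxtens_index (i, k)) (mxtens_index (j, k')) =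
                    poly_eval (p i j) k k') -> mxeval X p = M.
Proof.
move=> E; apply/matrixP => s t.
case: (mxtens_indexP s) => i k; case: (mxtens_indexP t) => j k'.
by rewrite mxevalE E.
Qed.

Lemma mxeval_zmod_morphism m l : zmod_morphism (@mxeval R g m l n X).
Proof.
move=> p q; apply: mxeval_eqP => i k j k'.
by rewrite !mxE !mxevalE /poly_eval raddfB !mxE.
Qed.

HB.instance Definition _ m l := GRing.isZmodMorphism.Build
  'M[A]_(m, l) 'M[R]_(m * n, l * n) (@mxeval R g m l n X)
  (@mxeval_zmod_morphism m l).

Lemma mxevalM m l r (p : 'M[A]_(m, l)) (q : 'M[A]_(l, r)) :
  mxeval X (p *m q) = mxeval X p *m mxeval X q.
Proof.
apply: mxeval_eqP => i k j k'; rewrite !mxE /poly_eval raddf_sum summxE /=.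
rewrite sum_mxtens; apply: eq_bigr => a _.
rewrite -/(poly_eval _) poly_evalM mxE.
by apply: eq_bigr => b _; rewrite !mxevalE.
Qed.

Lemma mxeval_star m l (p : 'M[A]_(m, l)) :
  mxeval X (mxstar p) = (mxeval X p)^T.
Proof.
apply: mxeval_eqP => i k j k'.
by rewrite mxE mxevalE !mxE poly_eval_star mxE.
Qed.

(** The vector of R^l (x) R^n whose l components in R^n are the rows of W. *)
Definition stack l (W : 'M[R]_(l, n)) : 'cV[R]_(l * n) :=
  \col_s W (mxtens_unindex s).1 (mxtens_unindex s).2.

Lemma mxeval_stack m l (p : 'M[A]_(m, l)) (W : 'M[R]_(l, n)) i k :
  (mxeval X p *m stack W) (mxtens_index (i, k)) 0 =
  (\sum_j poly_eval (p i j) *m (row j W)^T) k 0.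
Proof.
rewrite mxE sum_mxtens summxE; apply: eq_bigr => j _.
by rewrite mxE; apply: eq_bigr => k' _; rewrite mxevalE !mxE mxtens_indexK.
Qed.
End Evaluation.

(** * The zero radical is a real left module *)

Section Radicals.
Variables (R : realType) (g l : nat).
Local Notation A := (ncpoly R g).
Implicit Types I : set 'rV[A]_l.

Lemma mxeval_rows m n X (M : 'M[A]_(m, l)) (v : 'cV[R]_(l * n)) :
  (forall i, mxeval X (row i M) *m v = 0) -> mxeval X M *m v = 0.
Proof.
move=> Mv; apply/matrixP => s t; case: (mxtens_indexP s) => i k.
rewrite -[RHS](_ : (mxeval X (row i M) *m v) (mxtens_index (0, k)) t = _);
  last by rewrite Mv !mxE.
rewrite !mxE; apply: eq_bigr => r _; case: (mxtens_indexP r) => j k'.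
by rewrite !mxevalE mxE.
Qed.

Lemma sub_zero_radical I : (I `<=` zero_radical I)%classic.
Proof. by move=> p Ip n Xv; apply. Qed.

Lemma zero_radicalB I p q :
  zero_radical I p -> zero_radical I q -> zero_radical I (p - q).
Proof.
by move=> Zp Zq n Xv Z; rewrite raddfB /= mulmxBl Zp // Zq // subrr.
Qed.

Lemma zero_radical_left_module I : left_module (zero_radical I).
Proof.
split=> [|a p q Ip Iq]; rewrite inE => n Xv Z.
  by rewrite raddf0 mul0mx.
move: Ip Iq; rewrite !inE => /(_ _ _ Z) Ip /(_ _ _ Z) Iq.
rewrite raddfD /= -(mul_scalar_mx a p) mxevalM mulmxDl -mulmxA.
by rewrite Ip mulmx0 Iq add0r.
Qed.

(** At a zero (X, v), the quadratic form v^T (_)(X) v kills the rows of I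
    and their adjoints, and turns a sum of squares into a sum of squared
    norms. *)
Lemma zero_radical_real I : real_module (zero_radical I).
Proof.
move=> k p [M IM [N IN MN]] i n Xv Z.
set X := Xv.1; set v := Xv.2.
have M0 : mxeval X M *m v = 0 by apply: mxeval_rows => j; exact: IM.
have N0 : mxeval X N *m v = 0 by apply: mxeval_rows => j; exact: IN.
have := congr1 (fun P => v^T *m (mxeval X P *m v)) MN.
rewrite raddfD /= mulmxDl M0 add0r mxeval_star mulmxA -trmx_mul N0.
rewrite trmx0 mul0mx.
rewrite raddf_sum /= mulmx_suml mulmx_sumr => /esym/matrixP/(_ 0 0).
rewrite summxE mxE => /eqP.
have E j : (v^T *m (mxeval X (mxstar (p j) *m p j) *m v)) 0 0 =
    \sum_s (mxeval X (p j) *m v) s 0 ^+ 2.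
  rewrite mxevalM mxeval_star -mulmxA mulmxA -trmx_mul mxE.
  by apply: eq_bigr => s _; rewrite mxE -expr2.
under eq_bigr do rewrite E.
rewrite psumr_eq0 => [/allP|j _].
  move=> /(_ i (mem_index_enum _)); rewrite -E => /eqP E0.
  apply: trmx_inj; rewrite trmx0; apply: gram_eq0.
  rewrite trmxK trmx_mul -/X -/v; apply/matrixP => a b.
  rewrite (ord1 a) (ord1 b) [RHS]mxE -E0 mxevalM mxeval_star.
  by rewrite !mulmxA.
by apply: sumr_ge0 => s _; exact: sqr_ge0.
Qed.
End Radicals.

(** * Coefficients of polynomials and of rows *)

Section Coefficients.
Variables (R : realType) (g l : nat).
Local Notation A := (ncpoly R g).
Local Notation E := ('I_g + 'I_g)%type.
Implicit Types (p q : 'rV[A]_l) (w : word g).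

Definition letter_word (a : E) : word g := FMonom [:: a].

Lemma letter_starK : involutive (@letter_star g).
Proof. by case. Qed.

Lemma word_starK : involutive (@word_star g).
Proof.
case=> s; rewrite /word_star /=; congr FMonom.
by rewrite map_rev revK -map_comp map_id_in // => a _; exact: letter_starK.
Qed.

Lemma mcoeff_star (p : A) w : (star p)@_w = p@_(word_star w).
Proof.
rewrite /star {3}[p]monalgE !raddf_sum /=; apply: eq_bigr => u _.
by rewrite !mcoeffU -(can_eq word_starK u) word_starK.
Qed.

Lemma malgU1 : << 1%R *g mone >> = 1 :> A.
Proof. by []. Qed.

Lemma affineE (p : A) : (mmeasure (@fdeg (letter g)) p <= 2)%N ->
  p = << p@_mone *g mone >> +
      \sum_a << p@_(letter_word a) *g letter_word a >>.
Proof.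
move=> deg_p; apply/malgP => w; rewrite mcoeffD raddf_sum /= mcoeffU.
case: (eqVneq mone w) => [<-|w1].
  rewrite mulr1n big1 ?addr0 // => a _; rewrite mcoeffU.
  by case: eqP => // /(congr1 (@fmonom_val _)); rewrite fm1.
rewrite mulr0n add0r.
case: w w1 => [[|b [|c s]]] w1.
- by case/eqP: w1; apply: val_inj; rewrite /= fm1.
- rewrite (bigD1 b isT) /= [X in _ = X + _]mcoeffU eqxx mulr1n.
  rewrite big1 => [|a ab]; first by rewrite addr0.
  by rewrite mcoeffU; case: eqP => // -[] abE; rewrite abE eqxx in ab.
rewrite big1 => [|a _]; last by rewrite mcoeffU; case: eqP => // -[].
apply/eqP; rewrite mcoeff_eq0.
apply: (mmeasure_mnm_ge (mf := @fdeg (letter g))).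
exact: leq_trans deg_p _.
Qed.

Lemma mcoeff_mul_letter (q : A) c a s b :
  (q * << c *g letter_word a >>)@_(FMonom (rcons s b)) =
  if a == b then q@_(FMonom s) * c else 0.
Proof.
rewrite malgM_def fgmulgU raddf_sum /=.
under eq_bigr => w _.
  rewrite mcoeffU (_ : (_ == _) = (w == FMonom s) && (a == b)); last first.
    by rewrite -val_eqE /= fmM /= cats1 eqseq_rcons -val_eqE.
  over.
case: (a == b); last by rewrite big1 // => w _; rewrite andbF.
rewrite [in RHS](monalgE q) raddf_sum /= mulr_suml; apply: eq_bigr => w _.
by rewrite andbT mcoeffU mulrnAl.
Qed.

Lemma sum_mul_delta (F : 'I_l -> A) j : \sum_i F i * (i == j)%:R = F j.
Proof.
rewrite (bigD1 j) //= eqxx mulr1 big1 ?addr0 // => i /negPf ij.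
by rewrite ij mulr0.
Qed.

Lemma mxcoefP p q : (forall w, mxcoef w p = mxcoef w q) -> p = q.
Proof.
move=> pq; apply/matrixP => i j; rewrite (ord1 i); apply/malgP => w.
by have /matrixP/(_ 0 j) := pq w; rewrite !mxE.
Qed.

Lemma mxcoefB w p q : mxcoef w (p - q) = mxcoef w p - mxcoef w q.
Proof. exact: map_mxB. Qed.

Definition monom_row (w : word g) (c : 'rV[R]_l) : 'rV[A]_l :=
  map_mx (fun x => << x *g w >>) c.

Lemma mxcoef_monom_row w u (c : 'rV[R]_l) :
  mxcoef w (monom_row u c) = if u == w then c else 0.
Proof.
by apply/matrixP => i j; rewrite !mxE mcoeffU; case: eqP => _; rewrite ?mxE.
Qed.

Definition homog_row k (f : seq E -> 'rV[R]_l) : 'rV[A]_l :=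
  \sum_(t : k.-tuple E) monom_row (FMonom (t : seq E)) (f t).

Lemma mxcoef_homog_row w k f :
  mxcoef w (homog_row k f) = if size w == k then f w else 0.
Proof.
rewrite /homog_row /mxcoef raddf_sum /=.
under eq_bigr do rewrite -/(mxcoef _ _) mxcoef_monom_row.
rewrite -big_mkcond; case: eqP => [wk|wk].
  by rewrite (big_pred1 (Tuple (introT eqP wk))).
rewrite big_pred0 // => t; apply/eqP => tw; apply: wk.
by rewrite -tw /= size_tuple.
Qed.

Lemma ex_degree_bound p : exists d, forall w, (d < size w)%N -> mxcoef w p = 0.
Proof.
exists (\max_j mmeasure (@fdeg (letter g)) (p 0%R j))%N => w dw.
apply/matrixP => i j; rewrite (ord1 i) !mxE; apply: mcoeff_outdom.
apply: (mmeasure_mnm_ge (mf := @fdeg (letter g))).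
by apply: leq_trans (ltnW dw); exact: (leq_bigmax j).
Qed.
End Coefficients.

(** * Monic linear pencils *)

Section Pencils.
Variables (R : realType) (g l : nat) (L : 'M[ncpoly R g]_l).
Local Notation A := (ncpoly R g).
Local Notation E := ('I_g + 'I_g)%type.
Hypothesis Lpencil : linear_pencil L.

Definition letter_coef (a : E) : 'M[R]_l := mxcoef (letter_word a) L.

Lemma letter_coef_star (a : E) :
  letter_coef (letter_star a) = (letter_coef a)^T.
Proof.
apply/matrixP => i j; rewrite !mxE -[in LHS]Lpencil.1 !mxE mcoeff_star.
by rewrite /word_star /= letter_starK.
Qed.

Hypothesis Lmonic : monic_mx L.

Lemma mxcoef_one : mxcoef mone L = 1%:M.
Proof.
have eval0 w : word_eval (fun=> 0 : 'M[R]_1) w = (w == mone)%:R%:M.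
  case: w => [[|a s]].
    rewrite /word_eval big_nil (_ : _ == _) //.
    by apply/eqP/val_inj; rewrite /= fm1.
  rewrite /word_eval big_cons (_ : (_ == _) = false); last first.
    by apply/negP => /eqP/(congr1 (@fmonom_val _)); rewrite fm1.
  case: a => a /=; rewrite ?trmx0 mul0mx.
    by apply/matrixP => i j; rewrite !mxE mul0rn.
  by apply/matrixP => i j; rewrite !mxE mul0rn.
apply/matrixP => i j.
have /matrixP/(_ (mxtens_index (i, 0)) (mxtens_index (j, 0))) := Lmonic.
rewrite mxevalE => Lij; rewrite mxE.
transitivity (poly_eval (fun=> 0 : 'M[R]_1) (L i j) 0 0).
  rewrite /poly_eval /linext {1}[L i j]monalgE raddf_sum summxE /=.
  by apply: eq_bigr => w _; rewrite mcoeffU !mxE eval0 !mxE mulr_natr.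
rewrite Lij !mxE; congr (_%:R); congr nat_of_bool.
by rewrite (can_eq (@mxtens_indexK l 1)) xpair_eqE andbT.
Qed.

Lemma pencilE i j :
  L i j = (i == j)%:R + \sum_a << letter_coef a i j *g letter_word a >>.
Proof.
have Lij1 : (L i j)@_mone = (i == j)%:R.
  by have /matrixP/(_ i j) := mxcoef_one; rewrite !mxE.
have := affineE (Lpencil.2 i j).
have -> : << (L i j)@_mone *g mone >> = (i == j)%:R :> A.
  by rewrite Lij1; case: (i == j); rewrite ?malgU1 ?monalgU0.
move=> LE; apply: (etrans LE); apply: (congr1 (+%R _)).
by apply: eq_bigr => a _; rewrite !mxE.
Qed.

Lemma mxcoef_mul_pencil (q : 'rV[A]_l) (s : seq E) (b : E) :
  mxcoef (FMonom (rcons s b)) (q *m L) =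
  mxcoef (FMonom (rcons s b)) q + mxcoef (FMonom s) q *m letter_coef b.
Proof.
apply/matrixP => i0 j; rewrite (ord1 i0) !mxE.
under eq_bigr do rewrite pencilE mulrDr mulr_sumr.
rewrite big_split /= sum_mul_delta mcoeffD; congr (_ + _).
rewrite raddf_sum /=; apply: eq_bigr => i _; rewrite [mxcoef _ q 0 i]mxE.
transitivity (\sum_a
    (q 0 i * << letter_coef a i j *g letter_word a >>)@_(FMonom (rcons s b))).
  exact: raddf_sum.
under eq_bigr do rewrite mcoeff_mul_letter.
by rewrite -big_mkcond big_pred1_eq.
Qed.

Lemma row_moduleD p q :
  row_module L p -> row_module L q -> row_module L (p + q).
Proof. by move=> [u _ <-] [v _ <-]; exists (u + v) => //; rewrite mulmxDl. Qed.

(** Here c w L = c w: the row is its own multiplier. *)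
Lemma monom_row_in_row_module w c :
  (forall a, c *m letter_coef a = 0) -> row_module L (monom_row w c).
Proof.
move=> cL; exists (monom_row w c) => //.
apply/matrixP => i j; rewrite (ord1 i) {i} !mxE.
under eq_bigr do rewrite pencilE mulrDr mulr_sumr mxE.
rewrite big_split /= exchange_big /= [X in _ + X]big1 ?addr0 => [|a _].
  exact: (sum_mul_delta (fun i => << c 0 i *g w >>)).
under eq_bigr do rewrite malgM_def fgmulUU.
rewrite -raddf_sum /=; have /matrixP/(_ 0 j) := cL a; rewrite !mxE => ->.
by rewrite monalgU0.
Qed.

Lemma poly_eval_pencil n (X : 'I_g -> 'M[R]_n) i j :
  poly_eval X (L i j) =
  (i == j)%:R%:M + \sum_a letter_coef a i j *: letter_eval X a.
Proof.
rewrite pencilE /poly_eval raddfD raddf_sum /=; congr (_ + _).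
  case: (i == j); last by rewrite !raddf0.
  by rewrite -malgU1 linextU word_eval1 scale1r.
by apply: eq_bigr => a _; rewrite linextU /word_eval big_seq1.
Qed.

Lemma pencil_zeros n (X : 'I_g -> 'M[R]_n) (W : 'M[R]_(l, n)) :
  W + \sum_a letter_coef a *m W *m (letter_eval X a)^T = 0 ->
  zeros (row_module L) (X, stack W).
Proof.
move=> W0 _ [q _ <-]; rewrite mxevalM -mulmxA /=.
suff -> : mxeval X L *m stack W = 0 by rewrite mulmx0.
apply/matrixP => r o; rewrite (ord1 o); case: (mxtens_indexP r) => i k {r o}.
rewrite mxeval_stack [RHS]mxE.
suff -> : \sum_j poly_eval X (L i j) *m (row j W)^T =
          (row i (W + \sum_a letter_coef a *m W *m (letter_eval X a)^T))^T.
  by rewrite W0 !mxE.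
under eq_bigr do rewrite poly_eval_pencil mulmxDl mul_scalar_mx mulmx_suml.
rewrite big_split /= exchange_big linearD linearD /=; congr (_ + _).
  rewrite (bigD1 i) //= eqxx scale1r big1 ?addr0 // => j /negPf ij.
  by rewrite eq_sym ij scale0r.
rewrite !linear_sum; apply: eq_bigr => a _ /=.
rewrite row_mul trmx_mul trmxK row_mul (mulmx_sum_row (row i _)).
rewrite linear_sum mulmx_sumr /=; apply: eq_bigr => j _.
by rewrite linearZ /= -scalemxAl -scalemxAr [row i (letter_coef a) 0 j]mxE.
Qed.

Lemma zero_radical_eval (p : 'rV[A]_l) n (X : 'I_g -> 'M[R]_n)
    (W : 'M[R]_(l, n)) :
  zero_radical (row_module L) p ->
  W + \sum_a letter_coef a *m W *m (letter_eval X a)^T = 0 ->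
  \sum_j poly_eval X (p 0 j) *m (row j W)^T = 0.
Proof.
move=> Zp /pencil_zeros/Zp /= pW0.
by apply/matrixP => k o; rewrite (ord1 o) -mxeval_stack pW0 !mxE.
Qed.
End Pencils.

(** * The chain attached to a word *)

Section Chain.
Variables (R : realType) (g m : nat).
Local Notation E := ('I_g + 'I_g)%type.
Local Notation star := (@letter_star g).
Variables (T : E -> 'M[R]_m) (y : E -> 'cV[R]_m) (s : seq E).
Hypothesis Tstar : forall a, T (star a) = (T a)^T.
Local Notation d := (size s).+1.

Definition enter (a : E) : 'M[R]_(d, m) :=
  \matrix_(i, j) ((i == 0 :> nat)%:R * y a j 0).

Definition climb (a : E) : 'M[R]_d :=
  \matrix_(i, j) ((i == j.+1 :> nat) && (onth s j == Some a))%:R.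

(** Besides the moves up by [enter] and [climb], the transposed moves down are
    what makes [chain_op (star a)] the transpose of [chain_op a]. *)
Definition chain_op (a : E) : 'M[R]_(m + d) :=
  block_mx (T a) (enter (star a))^T
           (enter a) (climb a + (climb (star a))^T).

Definition chain (i : 'I_g) := chain_op (inl i).

Lemma enterT a : (enter a)^T = y a *m delta_mx 0 ord0.
Proof.
by apply/matrixP => i j; rewrite !mxE big_ord1 !mxE mulrC.
Qed.

Lemma letter_eval_chain a : letter_eval chain a = chain_op a.
Proof.
case: a => i //=; rewrite /chain /chain_op tr_block_mx /= trmxK linearD /=.
by rewrite trmxK addrC -(Tstar (inl i)).
Qed.

Definition height (u : 'cV[R]_m) (w : seq E) (k : 'I_d) : R :=
  (word_eval chain (FMonom w) *m col_mx u 0) (rshift m k) 0.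

Lemma height_cons u b w k : height u (b :: w) k =
  (k == 0 :> nat)%:R *
    ((y b)^T *m usubmx (word_eval chain (FMonom w) *m col_mx u 0)) 0 0 +
  \sum_(j : 'I_d)
     ((k == j.+1 :> nat) && (onth s j == Some b))%:R * height u w j +
  \sum_(j : 'I_d)
     ((j == k.+1 :> nat) && (onth s k == Some (star b)))%:R * height u w j.
Proof.
rewrite /height {1}/word_eval big_cons -/(word_eval _ (FMonom w)).
rewrite letter_eval_chain -mulmxA; set v := word_eval _ _ *m _.
rewrite -[v in LHS]vsubmxK mul_block_col col_mxEd mulmxDl addrA !mxE.
congr (_ + _ + _).
- by rewrite mulr_sumr; apply: eq_bigr => j _; rewrite !mxE mulrA.
- by apply: eq_bigr => j _; rewrite !mxE.
by apply: eq_bigr => j _; rewrite !mxE.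
Qed.

(** Each letter climbs at most one step, and the first step of the chain has
    index 0. *)
Lemma height_low u w (k : 'I_d) : (size w <= k)%N -> height u w k = 0.
Proof.
elim: w k => [|b w IH] k le_wk.
  by rewrite /height /word_eval big_nil mul1mx col_mxEd mxE.
rewrite height_cons gtn_eqF ?(leq_trans _ le_wk) //= mul0r add0r.
rewrite !big1 ?addr0 // => j _.
  case: eqP => [jk|_]; last by rewrite mul0r.
  by rewrite IH ?mulr0 // jk ltnW // ltnW.
case: eqP => [kj|_]; last by rewrite mul0r.
by rewrite IH ?mulr0 //; rewrite kj in le_wk.
Qed.

(** A word that reaches step k in k + 1 letters never goes down, so its letters
    are forced: after the entering letter, which acts first and is
    therefore the last of the word, come the first k letters of s. *)
Lemma height_top u w (k : 'I_d) : size w = k.+1 ->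
  height u w k =
  \sum_a (w == rcons (rev (take k s)) a)%:R * ((y a)^T *m u) 0 0.
Proof.
elim: w k => // b w IH k [wk]; rewrite height_cons.
rewrite [X in _ + X]big1 ?addr0 => [|j _]; last first.
  case: eqP => [jk|_]; last by rewrite mul0r.
  by rewrite height_low ?mulr0 // jk wk.
have [k0|k0] := posnP k.
  rewrite k0 take0 /= big1 ?addr0 => [|j _]; last by rewrite mul0r.
  move: wk; rewrite k0 => /size0nil ->.
  rewrite /word_eval big_nil mul1mx col_mxKu mul1r.
  rewrite (bigD1 b) //= eqxx mul1r big1 ?addr0 // => a ab.
  by rewrite eqseq_cons eq_sym (negPf ab) mul0r.
rewrite mul0r add0r.
have lt_k : (k.-1 < size s)%N by rewrite prednK // -ltnS.
pose j : 'I_d := Ordinal (ltnW lt_k : (k.-1 < d)%N).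
rewrite (bigD1 j) //= big1 ?addr0 => [|i ij]; last first.
  case: eqP => [ki|_]; last by rewrite mul0r.
  by case/eqP: ij; apply: val_inj; rewrite /= ki.
rewrite prednK // eqxx /= IH ?prednK // mulr_sumr; apply: eq_bigr => a _.
rewrite mulrA -natrM mulnb; congr (_%:R * _); congr nat_of_bool.
have -> : take k s = rcons (take k.-1 s) (nth b s k.-1).
  by rewrite -[X in take X s](prednK k0) (take_nth b).
rewrite rev_rcons /= eqseq_cons; congr (_ && _).
have : onth s k.-1 by rewrite onthTE.
case E1: (onth s k.-1) => [x|] //= _.
by rewrite (onth_nth b _ _ _ E1) eq_sym.
Qed.
End Chain.

(** * Rows that vanish at all zeros of the pencil *)

Section Separation.
Variables (R : realType) (g l : nat) (L : 'M[ncpoly R g]_l).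
Local Notation A := (ncpoly R g).
Local Notation E := ('I_g + 'I_g)%type.
Implicit Types (p q : 'rV[A]_l) (w : word g).
Hypothesis Lpencil : linear_pencil L.
Hypothesis Lmonic : monic_mx L.

(** Degree zero: the ground level alone is a zero of the pencil. *)
Lemma constant_in_kernel p : zero_radical (row_module L) p ->
  (forall w, (0 < size w)%N -> mxcoef w p = 0) ->
  forall a, mxcoef mone p *m letter_coef L a = 0.
Proof.
move=> Zp p0.
have [m [V [T [Ts VA V0]]]] := ground_level (letter_coef_star Lpencil).
apply: VA; apply: trmx_inj; rewrite trmx0.
pose X i := T (inl i).
have XT a : letter_eval X a = T a.
  by case: a => i //=; rewrite -(Ts (inl i)).
rewrite -(zero_radical_eval Lpencil Lmonic (X := X) (W := V) Zp); last first.
  by under eq_bigr do rewrite XT.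
rewrite mulmx_sum_row linear_sum; apply: eq_bigr => j _ /=.
transitivity (linext (fun w => (w == mone)%:R *: 1%:M) (p 0 j) *m (row j V)^T).
  by rewrite linext_delta linearZ /= -scalemxAl mul1mx mxE.
congr (_ *m _); apply: eq_bigr => w _.
case: eqP => [->|w1]; first by rewrite word_eval1 scale1r.
have /matrixP/(_ 0 j) : mxcoef w p = 0.
  apply: p0; rewrite lt0n; apply/eqP => /size0nil wE.
  by apply: w1; apply: val_inj; rewrite /= wE fm1.
by rewrite !mxE => ->; rewrite !scale0r.
Qed.

(** Otherwise the Fredholm alternative provides the entering vectors of a chain
    along s whose last coordinate separates p from zero. *)
Lemma top_coefs_mod_pencil p (s : seq E) : zero_radical (row_module L) p ->
  (forall w, ((size s).+1 < size w)%N -> mxcoef w p = 0) ->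
  exists u : 'rV[R]_l, forall a b,
    (mxcoef (FMonom (rcons s a)) p - u *m letter_coef L a)
      *m letter_coef L b = 0.
Proof.
move=> Zp p0.
have [m [V [T [Ts VA V0]]]] := ground_level (letter_coef_star Lpencil).
pose c a : 'rV[R]_l := mxcoef (FMonom (rcons s a)) p.
have [[u cu]|[y By by_n0]] :=
    fredholm_alternative (fun a => c a *m V) (fun a => letter_coef L a *m V).
  exists u => a; apply: VA.
  by rewrite mulmxBl -mulmxA -cu subrr.
case/eqP: by_n0.
(* The letters of s act from right to left, hence the reversal. *)
pose X := chain T y (rev s).
pose W := row_mx V (0 : 'M_(l, (size (rev s)).+1)).
have W0 : W + \sum_a letter_coef L a *m W *m (letter_eval X a)^T = 0.
  have -> : \sum_a letter_coef L a *m W *m (letter_eval X a)^T =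
      row_mx (\sum_a letter_coef L a *m V *m (T a)^T)
             ((\sum_a letter_coef L a *m V *m y a) *m delta_mx 0 ord0).
    rewrite mulmx_suml; apply: (big_ind3 (fun M N P => M = row_mx N P)).
    - by rewrite row_mx0.
    - by move=> ? ? ? ? ? ? -> ->; rewrite add_row_mx.
    move=> a _; rewrite letter_eval_chain // /chain_op tr_block_mx mul_mx_row.
    by rewrite mulmx0 mul_row_block !mul0mx !addr0 enterT mulmxA.
  by rewrite By mul0mx add_row_mx V0 addr0 row_mx0.
have := zero_radical_eval Lpencil Lmonic Zp W0.
move=> /matrixP/(_ (rshift m ord_max) 0); rewrite summxE [RHS]mxE => sum0.
apply/matrixP => i o; rewrite (ord1 i) (ord1 o) [RHS]mxE -{}sum0.
under eq_bigr do rewrite (mulmx_sum_row (c _)) mulmx_suml.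
rewrite exchange_big summxE; apply: eq_bigr => j _ /=.
rewrite row_row_mx row0 tr_row_mx trmx0.
pose f a : R^o := ((y a)^T *m (row j V)^T) 0 0.
pose h w : R^o :=
  height T y (row j V)^T w (ord_max : 'I_(size (rev s)).+1).
transitivity (linext h (p 0 j)); last first.
  rewrite /poly_eval /linext mulmx_suml summxE; apply: eq_bigr => w _.
  by rewrite -scalemxAl mxE /h /height fmK.
pose delta a w : R^o := (w == FMonom (rcons s a))%:R *: f a.
transitivity (linext (fun w => \sum_a delta a w) (p 0 j)).
  rewrite /linext; under [RHS]eq_bigr do rewrite scaler_sumr.
  rewrite exchange_big summxE; apply: eq_bigr => a _ /=.
  rewrite -/(linext (delta a) (p 0 j)) linext_delta /f -trmx_mul.
  by rewrite [in RHS]mxE -scalemxAl mxE /c mxE.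
apply: eq_bigr => w _; rewrite /h /delta /f.
have [ws|ws|ws] := ltngtP (size w) (size s).+1.
- rewrite height_low ?size_rev // big1 // => a _.
  case: eqP => [wE|]; last by rewrite scale0r.
  by rewrite wE /= size_rcons ltnn in ws.
- have /matrixP/(_ 0 j) := p0 _ ws; rewrite !mxE => ->.
  by rewrite !scale0r.
rewrite height_top //= ?size_rev // take_oversize ?size_rev // revK.
by congr (_ * _); apply: eq_bigr => a _; rewrite -val_eqE.
Qed.

Lemma zero_radical_sub_row_module p :
  zero_radical (row_module L) p -> row_module L p.
Proof.
have [d] := ex_degree_bound p.
elim: d p => [|k IH] p p0 Zp.
  rewrite (_ : p = monom_row mone (mxcoef mone p)).
    by apply: monom_row_in_row_module => //; exact: constant_in_kernel.
  apply: mxcoefP => w; rewrite mxcoef_monom_row; case: eqP => [<- //|w1].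
  apply: p0; rewrite lt0n; apply/eqP => /size0nil wE.
  by apply: w1; apply: val_inj; rewrite /= wE fm1.
have /boolp.choice [u uP] : forall s : seq E, exists u : 'rV[R]_l,
    size s = k -> forall a b,
    (mxcoef (FMonom (rcons s a)) p - u *m letter_coef L a)
      *m letter_coef L b = 0.
  move=> s; have [sk|sk] := eqVneq (size s) k; last first.
    by exists 0 => sk'; rewrite sk' eqxx in sk.
  have [|u uP] := @top_coefs_mod_pencil p s Zp; first by rewrite sk.
  by exists u.
(* In degree k + 1, p1 has only coefficients killed by all letter coefficients;
   r is that part of p1. *)
pose q := homog_row k u; pose p1 := p - q *m L.
pose r := homog_row k.+1 (fun s => mxcoef (FMonom s) p1).
have p1E s a : (k <= size s)%N -> mxcoef (FMonom (rcons s a)) p1 =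
    mxcoef (FMonom (rcons s a)) p -
    (if size s == k then u s *m letter_coef L a else 0).
  move=> ks; rewrite mxcoefB mxcoef_mul_pencil // !mxcoef_homog_row /=.
  by rewrite size_rcons gtn_eqF // add0r; case: eqP => // _; rewrite mul0mx.
have rL : row_module L r.
  rewrite /r /homog_row; apply: big_ind => [||t _].
  - by exists 0 => //; rewrite mul0mx.
  - exact: row_moduleD.
  apply: monom_row_in_row_module => // b.
  have := size_tuple t; case/lastP: (t : seq E) => [//|s a].
  rewrite size_rcons => -[sk]; rewrite p1E ?sk // eqxx.
  exact: uP.
have qL : row_module L (q *m L) by exists q.
rewrite (_ : p = (p1 - r) + (r + q *m L)); last first.
  by rewrite addrA subrK /p1 subrK.
have sub_Z := @sub_zero_radical _ _ _ (row_module L).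
apply: row_moduleD; last exact: row_moduleD.
apply: IH; last first.
  by apply: zero_radicalB (sub_Z _ rL); apply: zero_radicalB (sub_Z _ qL).
case=> w kw; rewrite mxcoefB mxcoef_homog_row /=.
case: eqP => [|wk]; first by rewrite subrr.
rewrite subr0; move: kw wk; case/lastP: w => [//|s a] /=.
rewrite size_rcons ltnS => ks wk.
rewrite p1E // ifN ?subr0; last by apply: contra_notN wk => /eqP ->.
apply: p0; rewrite /= size_rcons !ltnS ltn_neqAle ks andbT.
by apply/eqP => sk; rewrite sk in wk.
Qed.
End Separation.

Theorem proposition1p12 (R : realType) (g l : nat) (L : 'M[ncpoly R g]_l) :
  linear_pencil L -> monic_mx L ->
  row_module L = real_radical (row_module L) /\
  real_radical (row_module L) = zero_radical (row_module L).
Proof.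
move=> Lpencil Lmonic.
have ZE : zero_radical (row_module L) = row_module L.
  apply/seteqP; split; last exact: sub_zero_radical.
  exact: zero_radical_sub_row_module.
suff -> : real_radical (row_module L) = row_module L by rewrite ZE.
apply: smallest_id; rewrite -ZE.
by split; [exact: zero_radical_left_module | exact: zero_radical_real].
Qed.
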